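(* Let $n\ge2$, $\ell,r>0$, and let $$f\in C^1([-\ell,r]),\qquad f|_{[-\ell,0]}\in C^n([-\ell,0]).$$ Suppose that there are signs $\eta,\sigma\in\{-1,1\}$ such that $$\eta f^{(n)}(x)>0\quad(-\ell\le x\le0),$$ $$q\longmapsto\sigma f'(q)\ \text{ is strictly increasing on }[0,r].$$ Let $N_-(f)$ and $N_+(f)$ be the numbers of distinct zeros of $f$ in $[-\ell,0)$ and $(0,r]$ respectively, and let $z_0(f)=1$ if $f(0)=0$ and $z_0(f)=0$ otherwise. Then $$N_-(f)+z_0(f)+N_+(f)\le\begin{cases}n,&\eta\sigma=1,\\ n+1,&\eta\sigma=-1.\end{cases}$$ Every zero of $f$ is isolated.
   Context: On $[-\ell,0]$ the derivative $f^{(n)}$ is the derivative of the restriction $f|_{[-\ell,0]}$ (one-sided at the endpoints). *)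

(* Defs.v *)
From HB Require Import structures.
From mathcomp Require Import all_boot all_order all_algebra finmap.
From mathcomp Require Import all_classical all_reals all_analysis.
Import Order.TTheory GRing.Theory Num.Theory numFieldNormedType.Exports.
Set Implicit Arguments.
Unset Strict Implicit.
Unset Printing Implicit Defensive.
Local Open Scope classical_set_scope.
Local Open Scope ring_scope.

(* Derivatives of the restriction of [f] to [A]: difference quotients only use
   points of [A], so on a nondegenerate closed interval they are one-sided at
   the endpoints, and the values of [f] outside [A] play no role. Meaningful
   only at points of [A] that are limit points of [A]. *)
Definition diff_quot (R : realType) (f : R -> R) (x y : R) : R :=
  (f y - f x) / (y - x).

Definition derivable_in (R : realType) (A : set R) (f : R -> R) (x : R) : Prop :=
  cvg (diff_quot f x y @[y --> within A x^']).

Definition derive_in (R : realType) (A : set R) (f : R -> R) (x : R) : R :=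
  lim (diff_quot f x y @[y --> within A x^']).

Definition deriven_in (R : realType) (n : nat) (A : set R) (f : R -> R) : R -> R :=
  iter n (derive_in A) f.

(* Continuity of the derivatives of order [k < n] follows from their
   differentiability. *)
Definition Cn_on (R : realType) (n : nat) (A : set R) (f : R -> R) : Prop :=
  (forall k, (k < n)%N -> forall x, A x -> derivable_in A (deriven_in k A f) x) /\
  {within A, continuous (deriven_in n A f)}.

Definition zeros_in (R : realType) (A : set R) (f : R -> R) : set R :=
  [set x | A x /\ f x = 0].

(* Main.v *)
Require Import Defs.
From HB Require Import structures.
From mathcomp Require Import all_boot all_order all_algebra finmap.
From mathcomp Require Import all_classical all_reals all_analysis.
Import Order.TTheory GRing.Theory Num.Theory numFieldNormedType.Exports.
Local Open Scope classical_set_scope.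
Local Open Scope ring_scope.
Set Implicit Arguments.
Unset Strict Implicit.
Unset Printing Implicit Defensive.

(** The zeros of [f] are counted through those of [g := f'].  By Rolle's
theorem, [N] distinct zeros of [f] in [-l, r] produce [N - 1] distinct zeros
of [g] strictly between them, so it is enough to bound the zeros of [g].

On [-l, 0] the derivative of order [n - 1] of [g] has the constant sign [eta];
repeated use of Rolle's theorem gives at most [n - 1] zeros there
([size_zeros_deriven_in]).  On ]0, r] the function [g] is strictly monotone
and has at most one zero.  Hence [g] has at most [n] zeros and [f] at most
[n + 1], whatever the signs.

The case [eta = sigma] gains one because the two extremal situations exclude
each other.  If [g] has all its [n - 1] zeros in [-l, 0[, then, like a
polynomial of degree [n - 1] to the right of all its roots, it has at [0] the
sign of its derivative of order [n - 1]: [0 < eta * g 0]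
([deriven_in_pos_after_zeros]).  If moreover [g q = 0] with [0 < q], then
[sigma * g] is strictly increasing and vanishes at [q], so
[sigma * g 0 < 0].  Both cannot hold when [eta = sigma].  The point [0] itself
is not one of the zeros of [g] in that situation, again by monotonicity.

A bound on the length of every increasing list of zeros makes the zero set
finite, and a point of a finite set of reals is isolated. *)

(** * Derivatives relative to a set *)

(** A limit along a filter is determined only when the filter is proper: this
is what gives one-sided derivatives on a nondegenerate segment a meaning. *)
Lemma within_itv_dnbhs_proper (R : realType) (a b x : R) :
  a < b -> a <= x <= b -> ProperFilter (within `[a, b] x^').
Proof.
move=> ab /andP[ax xb].
apply: Build_ProperFilter_ex => W [e /= e0 We].
suff [y [yab yx ye]] : exists y, [/\ `[a, b]%classic y, y != x & `|x - y| < e].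
  by exists y; exact: We.
(* A nearby point is taken to the right of [x] if there is room, else to the
   left; the minimum or maximum keeps it inside the segment. *)
have e2 : 0 < e / 2 by rewrite divr_gt0.
have e2e : e / 2 < e by rewrite ltr_pdivrMr// ltr_pMr// ltr1n.
have [xltb|blex] := ltP x b.
- exists (Num.min b (x + e / 2)).
  have xm : x < Num.min b (x + e / 2) by rewrite lt_min xltb ltrDl.
  split.
  + by rewrite /= in_itv /= (le_trans ax (ltW xm)) ge_min lexx.
  + by rewrite gt_eqF.
  + by rewrite distrC gtr0_norm ?subr_gt0// ltrBlDl gt_min orbC ltrD2l e2e.
- have xE : x = b by apply/eqP; rewrite eq_le xb.
  exists (Num.max a (x - e / 2)).
  have xm : Num.max a (x - e / 2) < x.
    by rewrite gt_max {1}xE ab gtrDl oppr_lt0.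
  split.
  + by rewrite /= in_itv /= le_max lexx (le_trans (ltW xm)).
  + by rewrite lt_eqF.
  + rewrite gtr0_norm ?subr_gt0// ltrBlDl -ltrBlDr lt_max ltrD2l ltrN2.
    by rewrite e2e orbT.
Qed.

(** Restriction to a smaller segment refines the filter of punctured
neighbourhoods, hence keeps the limit of the difference quotients.  Applied to
[-l, 0] in [-l, r], it identifies at [0] the two-sided derivative with the
left one, which is what glues the two halves of the count. *)
Lemma derive_in_sub (R : realType) (A : set R) (a b : R) (f : R -> R) (x : R) :
  a < b -> `[a, b] `<=` A -> a <= x <= b -> derivable_in A f x ->
  derive_in `[a, b] f x = derive_in A f x.
Proof.
move=> ab abA xab df; have ? := within_itv_dnbhs_proper ab xab.
apply: cvg_lim => //; apply: cvg_trans df.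
by apply: cvg_fmap2; exact: within_subset.
Qed.

Lemma derivable_in_continuous (R : realType) (A : set R) (f : R -> R) :
  (forall x, A x -> derivable_in A f x) -> {within A, continuous f}.
Proof.
move=> df; apply/subspace_continuousP => x Ax.
have yx : y - x @[y --> within A x^'] --> 0.
  apply: cvg_within_filter; apply: cvg_within_filter.
  have := @cvgB R R R (nbhs x) _ id (cst x) x x cvg_id (cvg_cst x).
  by rewrite subrr; apply.
have lim0 : diff_quot f x y * (y - x) @[y --> within A x^'] --> (0 : R).
  by have := cvgM (df x Ax) yx; rewrite mulr0; apply.
apply/cvgrPdist_lt => e e0.
have hh : \forall y \near x, y != x -> A y ->
    `|0 - diff_quot f x y * (y - x)| < e.
  exact: (proj1 (cvgrPdist_lt _ _) lim0).
rewrite near_withinE.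
near=> y => Ay.
have [->|yx0] := eqVneq y x; first by rewrite subrr normr0.
have : `|0 - diff_quot f x y * (y - x)| < e by apply: (near hh y).
by rewrite sub0r normrN /diff_quot divfK ?subr_eq0// distrC.
Unshelve. all: by end_near. Qed.

(** Near an interior point the set imposes no constraint, which gives access to
the ordinary differential calculus. *)
Lemma is_derive_derive_in (R : realType) (A : set R) (f : R -> R) (x : R) :
  A° x -> derivable_in A f x -> is_derive x 1 f (derive_in A f x).
Proof.
move=> Ax df.
have fl : (fun h : R => h^-1 *: ((f \o shift x) (h *: 1) - f x)) @ 0^'
    --> derive_in A f x.
  have -> : (fun h : R => h^-1 *: ((f \o shift x) (h *: 1) - f x)) =
      diff_quot f x \o (fun h => h + x).
    apply/funext => h /=.
    by rewrite /diff_quot addrK /GRing.scale /= mulr1 mulrC.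
  apply: cvg_comp df => W.
  rewrite /within /= /dnbhs /within /= => -[e /= e0 We].
  move/nbhs_ballP : Ax => [d /= d0 dA].
  exists (Num.min e d) => /=; first by rewrite lt_min e0.
  move=> h /=; rewrite sub0r normrN lt_min => /andP[he hd] h0.
  apply: We => /=.
  - by rewrite opprD addrCA subrr addr0 normrN.
  - by rewrite -subr_eq0 addrK.
  - by apply: dA; rewrite /ball /= opprD addrCA subrr addr0 normrN.
apply: DeriveDef; first by apply/cvg_ex; exists (derive_in A f x).
exact: cvg_lim fl.
Qed.

Lemma MVT_in (R : realType) (a b x y : R) (f : R -> R) :
  (forall z, a <= z <= b -> derivable_in `[a, b] f z) ->
  a <= x -> x < y -> y <= b ->
  exists2 c, x < c < y & f y - f x = derive_in `[a, b] f c * (y - x).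
Proof.
move=> df ax xy yb.
have sub : `[x, y] `<=` `[a, b].
  move=> z /=; rewrite !in_itv /= => /andP[xz zy].
  by rewrite (le_trans ax) ?(le_trans zy).
have [||c] := @MVT R f (derive_in `[a, b] f) x y xy.
- move=> z; rewrite in_itv /= => /andP[xz zy].
  have zab : z \in `]a, b[ by rewrite in_itv /= (le_lt_trans ax xz) (lt_le_trans zy yb).
  apply: is_derive_derive_in.
    by have := near_in_itvoo zab; apply: filterS; exact: subset_itv_oo_cc.
  by apply: df; rewrite (le_trans ax (ltW xz)) (le_trans (ltW zy) yb).
- by apply: continuous_subspaceW sub _; exact: derivable_in_continuous.
- by rewrite in_itv /= => xcy ->; exists c.
Qed.

(** * Zeros of a function and of its derivative *)

(** The bound by [last x s] together with [path <%R x t] places the new list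
strictly between the first and the last zero; both sides are needed to iterate
inside the segment. *)
Lemma rolle_path (R : realType) (a b : R) (f : R -> R) (x : R) (s : seq R) :
  (forall z, a <= z <= b -> derivable_in `[a, b] f z) ->
  path <%R x s -> a <= x -> last x s <= b -> {in x :: s, forall z, f z = 0} ->
  exists t, [/\ size t = size s, path <%R x t,
    {in t, forall z, z < last x s} & {in t, forall z, derive_in `[a, b] f z = 0}].
Proof.
move=> df; elim: s x => [|y s IH] x /=; first by exists [::].
move=> /andP[xy ys] ax lb f0.
have yl : y <= last y s.
  case: s ys {IH lb f0} => //= z s /andP[yz]; rewrite (path_sortedE lt_trans).
  move=> /andP[/allP zs _]; apply: ltW.
  by have := mem_last z s; rewrite inE => /predU1P[->//|/zs]; exact: lt_trans.
have [|t [st pt tl dt]] := IH y ys (le_trans ax (ltW xy)) lb.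
  by move=> z zs; apply: f0; rewrite inE zs orbT.
have [c /andP[xc cy]] := MVT_in df ax xy (le_trans yl lb).
rewrite !f0 ?mem_head ?inE ?eqxx ?orbT// subrr => /esym/eqP.
rewrite mulf_eq0 subr_eq0 (gt_eqF xy) orbF => /eqP dc.
exists (c :: t); split => /=.
- by rewrite st.
- by rewrite xc /=; apply: path_le pt; [exact: lt_trans|].
- by move=> z; rewrite inE => /predU1P[->|/tl//]; exact: lt_le_trans yl.
- by move=> z; rewrite inE => /predU1P[->//|/dt].
Qed.

Lemma deriven_inSr (R : realType) (k : nat) (A : set R) (f : R -> R) :
  deriven_in k A (derive_in A f) = deriven_in k.+1 A f.
Proof. by rewrite /deriven_in iterSr. Qed.

(** The analogue of the fact that a polynomial of degree [m] with [m] real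
roots has, to the right of all of them, the sign of its leading coefficient.
By induction on [m]: between the last zero and [c] the mean value theorem
gives a point [d] with [h c] a positive multiple of [h' d], and [d] lies to
the right of the [m - 1] zeros of [h'] that Rolle's theorem provides. *)
Lemma deriven_in_pos_after_zeros (R : realType) (a b eta c : R) (m : nat)
    (h : R -> R) (s : seq R) :
  (forall k, (k < m)%N ->
    forall x, a <= x <= b -> derivable_in `[a, b] (deriven_in k `[a, b] h) x) ->
  (forall x, a <= x <= b -> 0 < eta * deriven_in m `[a, b] h x) ->
  size s = m -> sorted <%R s ->
  {in s, forall z, [/\ a <= z, z < c & h z = 0]} -> a <= c <= b ->
  0 < eta * h c.
Proof.
elim: m h s c => [|m IH] h s c dh pos; first by move=> _ _ _; exact: pos.
case: s => // x s [sm] /= pxs hs /andP[ac cb].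
have [_ lc hl] := hs _ (mem_last x s).
have [ax _ _] := hs _ (mem_head x s).
have dh0 : forall z, a <= z <= b -> derivable_in `[a, b] h z by exact: (dh 0%N).
have [|t [st pt tl dt]] := rolle_path dh0 pxs ax (le_trans (ltW lc) cb).
  by move=> z /hs[].
have al : a <= last x s by have [] := hs _ (mem_last x s).
have [d /andP[ld dc]] := MVT_in dh0 al lc cb.
rewrite hl subr0 => ->; rewrite mulrA mulr_gt0 ?subr_gt0//.
apply: (IH (derive_in `[a, b] h) t) => //.
- by move=> k km z zab; rewrite deriven_inSr; exact: dh.
- by move=> z zab; rewrite deriven_inSr; exact: pos.
- by rewrite st.
- exact: path_sorted pt.
- move=> z zt; split; last exact: dt.
  + move: pt; rewrite (path_sortedE lt_trans) => /andP[/allP xt _].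
    exact: le_trans ax (ltW (xt _ zt)).
  + exact: lt_trans (tl _ zt) ld.
- by rewrite (le_trans al (ltW ld)) (le_trans (ltW dc) cb).
Qed.

(** A zero of index [m] would lie to the right of [m] others, where the previous
lemma forces a nonzero value. *)
Lemma size_zeros_deriven_in (R : realType) (a b eta : R) (m : nat)
    (h : R -> R) (s : seq R) :
  (forall k, (k < m)%N ->
    forall x, a <= x <= b -> derivable_in `[a, b] (deriven_in k `[a, b] h) x) ->
  (forall x, a <= x <= b -> 0 < eta * deriven_in m `[a, b] h x) ->
  sorted <%R s -> {in s, forall z, a <= z <= b /\ h z = 0} -> (size s <= m)%N.
Proof.
move=> dh pos ss hs; rewrite leqNgt; apply/negP => ms.
have cs : nth 0 s m \in s by exact: mem_nth.
have [cab hc] := hs _ cs.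
suff : 0 < eta * h (nth 0 s m) by rewrite hc mulr0 ltxx.
apply: (deriven_in_pos_after_zeros (s := take m s) dh pos) => //.
- exact: size_takel (ltnW ms).
- exact: take_sorted.
- move=> z zt; have [/andP[az _] hz] := hs _ (mem_take zt).
  split=> //; move: ss; rewrite -{1}(cat_take_drop m s) (sorted_pairwise lt_trans).
  rewrite pairwise_cat (drop_nth 0 ms) => /andP[/allrelP].
  by move=> /(_ z (nth 0 s m) zt); rewrite mem_head => ->.
Qed.

(** * Gluing the two sides *)

(** The heart of the count, carried out on the zeros [t] of the derivative,
split at [0]: at most [n - 1] of them are [<= 0] and at most one is [> 0], and
for [eta = sigma] both bounds cannot be attained together. *)
Lemma size_zeros_glued (R : realType) (n : nat) (l r : R) (f : R -> R)
    (eta sigma : R) (s : seq R) :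
  (2 <= n)%N -> 0 < l -> 0 < r ->
  (forall x, - l <= x <= r -> derivable_in `[- l, r] f x) ->
  Cn_on n `[- l, 0] f ->
  (forall x, - l <= x <= 0 -> 0 < eta * deriven_in n `[- l, 0] f x) ->
  (forall p q : R, 0 <= p -> p < q -> q <= r ->
     sigma * derive_in `[- l, r] f p < sigma * derive_in `[- l, r] f q) ->
  sorted <%R s -> {in s, forall z, - l <= z <= r /\ f z = 0} ->
  (size s <= if eta == sigma then n else n.+1)%N.
Proof.
case: n => [|[|n]]// _ l0 r0 df [dfn _] pos incr.
set N := if _ then _ else _.
case: s => // x s /= pxs hs.
have [/andP[lx _] _] := hs _ (mem_head x s).
have [/andP[_ lr] _] := hs _ (mem_last x s).
have [|t [<- pt tl dt]] := rolle_path df pxs lx lr; first by move=> z /hs[].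
move: pt; rewrite (path_sortedE lt_trans) => /andP[/allP xt st].
have tlr z : z \in t -> - l <= z <= r.
  move=> zt; rewrite (le_trans lx (ltW (xt _ zt))).
  by rewrite (le_trans (ltW (tl _ zt)) lr).
have lt0 : - l < 0 by rewrite oppr_lt0.
have sub0 : `[- l, 0] `<=` `[- l, r].
  by move=> z /=; rewrite !in_itv /= => /andP[-> z0]; exact: le_trans z0 (ltW r0).
pose h := derive_in `[- l, 0] f.
have hE z : - l <= z <= 0 -> h z = derive_in `[- l, r] f z.
  move=> /[dup] zl0 /andP[lz z0]; apply: derive_in_sub => //.
  by apply: df; rewrite lz (le_trans z0 (ltW r0)).
have dh k : (k < n.+1)%N -> forall z, - l <= z <= 0 ->
    derivable_in `[- l, 0] (deriven_in k `[- l, 0] h) z.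
  by move=> kn z zl0; rewrite deriven_inSr; apply: dfn.
have posh z : - l <= z <= 0 -> 0 < eta * deriven_in n.+1 `[- l, 0] h z.
  by move=> zl0; rewrite deriven_inSr; exact: pos.
pose neg := [seq z <- t | z <= 0]; pose plus := [seq z <- t | ~~ (z <= 0)].
have sneg : sorted <%R neg by exact: (sorted_filter lt_trans).
have hneg z : z \in neg -> - l <= z <= 0 /\ h z = 0.
  rewrite mem_filter => /andP[z0 zt]; have /andP[lz _] := tlr _ zt.
  by rewrite hE ?lz// dt.
have negn : (size neg <= n.+1)%N by exact: size_zeros_deriven_in dh posh sneg hneg.
have tE : size t = (size neg + size plus)%N.
  by rewrite -(count_predC (fun z => z <= 0) t) -!size_filter.
have hplus z : z \in plus -> [/\ 0 < z, z <= r & derive_in `[- l, r] f z = 0].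
  rewrite mem_filter -ltNge => /andP[z0 zt]; have /andP[_ zr] := tlr _ zt.
  by split=> //; exact: dt.
have splus : sorted <%R plus by exact: (sorted_filter lt_trans).
case plusE : plus => [|q [|q' u]].
- rewrite tE plusE addn0 /N; case: ifP => _ //.
  exact: leqW.
- have [q0 qr gq] := hplus q ltac:(by rewrite plusE mem_head).
  (* [sigma * f'] increases to the value 0 at [q]. *)
  have g0 : sigma * h 0 < 0.
    by rewrite hE ?lexx ?ltW//; have := incr 0 q (lexx 0) q0 qr; rewrite gq mulr0.
  rewrite tE plusE addn1 /N; case: ifP => [/eqP es|_]; last by [].
  rewrite ltnS ltn_neqAle negn andbT; apply/eqP => nn.
  (* If the first bound is attained, [h] has the sign [eta] at 0. *)
  suff : 0 < eta * h 0 by rewrite es ltNge ltW.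
  apply: (deriven_in_pos_after_zeros dh posh nn sneg).
  + move=> z /hneg[/andP[lz z0] hz]; split=> //.
    rewrite lt_neqAle z0 andbT; apply/eqP => zE.
    by move: hz g0; rewrite zE => ->; rewrite mulr0 ltxx.
  + by rewrite lexx ltW.
(* Two positive zeros would contradict strict monotonicity. *)
- have [q0 qr gq] := hplus q ltac:(by rewrite plusE mem_head).
  have [q0' qr' gq'] := hplus q' ltac:(by rewrite plusE !inE eqxx orbT).
  have qq' : q < q' by move: splus; rewrite plusE /= => /andP[].
  by have := incr q q' (ltW q0) qq' qr'; rewrite gq gq' mulr0 ltxx.
Qed.

(** * Finiteness and isolation *)

Lemma isolated_finite_set (R : realType) (A : set R) (x : R) :
  finite_set A -> A x -> isolated A x.
Proof.
move=> fA Ax; have : ~ limit_point A x.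
  by move/limit_point_infinite_setP/(_ setT filterT); rewrite setTI.
rewrite not_limit_pointE => -[V xV AV]; split; first exact: mem_set.
exists V => //; apply/seteqP; split=> [y [Vy Ay]|y ->]; first exact: AV.
by split=> //; exact: nbhs_singleton.
Qed.

Lemma finite_set_sorted_bound (R : realType) (A : set R) (k : nat) :
  (forall s : seq R, sorted <%R s -> {in s, forall z, A z} -> (size s <= k)%N) ->
  finite_set A.
Proof.
move=> bnd; apply: contrapT => /(infinite_set_fset k.+1)[B BA].
apply/negP; rewrite -leqNgt -(size_sort <=%R); apply: bnd.
  by rewrite sort_lt_sorted fset_uniq.
by move=> z; rewrite mem_sort => zB; exact: BA.
Qed.

Unset Implicit Arguments.
Set Strict Implicit.
Set Printing Implicit Defensive.

Theorem theorem3p1 (R : realType) (n : nat) (l r : R) (f : R -> R)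
    (eta sigma : R) (hn : (2 <= n)%N) (hl : 0 < l) (hr : 0 < r)
    (hC1 : Cn_on 1 `[- l, r] f) (hCn : Cn_on n `[- l, 0] f)
    (heta : eta = -1 \/ eta = 1) (hsigma : sigma = -1 \/ sigma = 1)
    (hpos : forall x : R, - l <= x <= 0 -> 0 < eta * deriven_in n `[- l, 0] f x)
    (hincr : forall p q : R, 0 <= p -> p < q -> q <= r ->
       sigma * derive_in `[- l, r] f p < sigma * derive_in `[- l, r] f q) :
  let Zminus := zeros_in `[- l, 0[ f in
  let Zplus := zeros_in `]0, r] f in
  [/\ finite_set Zminus,
      finite_set Zplus,
      (#|` fset_set Zminus| + (f 0 == 0)%R + #|` fset_set Zplus|
         <= if (eta * sigma == 1)%R then n else n.+1)%N
    & forall x : R, zeros_in `[- l, r] f x -> isolated (zeros_in `[- l, r] f) x].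
Proof.
have signE : (eta * sigma == 1) = (eta == sigma).
  case: heta hsigma => -> [] ->; rewrite ?(mulrNN, mulr1, mul1r, eqxx)//.
have df x : - l <= x <= r -> derivable_in `[- l, r] f x.
  by move=> xlr; case: hC1 => d _; exact: (d 0%N).
have bound (s : seq R) : sorted <%R s -> {in s, forall z, zeros_in `[- l, r] f z} ->
    (size s <= if (eta * sigma == 1)%R then n else n.+1)%N.
  rewrite signE => ss hs.
  apply: (size_zeros_glued hn hl hr df hCn hpos hincr ss) => z /hs[].
  by rewrite /= in_itv.
have fin := finite_set_sorted_bound bound.
have subm : zeros_in `[- l, 0[ f `<=` zeros_in `[- l, r] f.
  move=> z [/=]; rewrite in_itv /= => /andP[lz z0] fz; split => //=.
  by rewrite in_itv /= lz (le_trans (ltW z0) (ltW hr)).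
have subp : zeros_in `]0, r] f `<=` zeros_in `[- l, r] f.
  move=> z [/=]; rewrite in_itv /= => /andP[z0 zr] fz; split => //=.
  by rewrite in_itv /= zr (le_trans _ (ltW z0))// oppr_le0 ltW.
move=> Zminus Zplus.
have finm : finite_set Zminus := sub_finite_set subm fin.
have finp : finite_set Zplus := sub_finite_set subp fin.
split=> //; last by move=> x; exact: isolated_finite_set.
(* The three cardinals are the lengths of the parts of one duplicate-free list
   of zeros; [nseq (f 0 == 0) 0] contains 0 exactly when 0 is a zero. *)
pose s := (fset_set Zminus ++ nseq (f 0 == 0) 0) ++ fset_set Zplus.
have memm z : z \in fset_set Zminus -> Zminus z by rewrite in_fset_set// inE.
have memp z : z \in fset_set Zplus -> Zplus z by rewrite in_fset_set// inE.
have mem0 z : z \in nseq (f 0 == 0) 0 -> z = 0 /\ f z = 0.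
  by rewrite mem_nseq; case: eqP => //= f0 /eqP ->.
have us : uniq s.
  rewrite !cat_uniq !fset_uniq /= andbT; apply/andP; split; [apply/andP; split|].
  - apply/hasPn => z /mem0[-> _]; apply/negP => /memm[/=].
    by rewrite in_itv /= ltxx andbF.
  - by case: (f 0 == 0).
  - apply/hasPn => z /memp[/=]; rewrite in_itv /= => /andP[z0 _] _.
    rewrite mem_cat negb_or; apply/andP; split; apply/negP.
      by move=> /memm[/=]; rewrite in_itv /= (lt_gtF z0) andbF.
    by move=> /mem0[zE _]; rewrite zE ltxx in z0.
have -> : (#|` fset_set Zminus| + (f 0 == 0)%R + #|` fset_set Zplus|)%N =
    size (sort <=%R s).
  by rewrite size_sort !size_cat size_nseq.
apply: bound; first by rewrite sort_lt_sorted.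
move=> z; rewrite mem_sort !mem_cat => /orP[/orP[/memm/subm//|]|/memp/subp//].
by move=> /mem0[-> f0]; split; rewrite //= in_itv /= oppr_le0 !ltW.
Qed.
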